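(* Let $\alpha$ and $\beta$ be LIF expressions such that $\beta$ is io-disjoint, i.e., $O^{\mathrm{sem}}(\beta)\cap I^{\mathrm{sem}}(\beta)=\emptyset$. Then $\alpha;\beta$ is equivalent to $$\mathrm{cyl}^r_{O^{\mathrm{sem}}(\beta)}(\alpha)\ \cap\ \mathrm{cyl}^l_{O^{\mathrm{sem}}(\alpha)}(\beta).$$
   Context: **Basic setting.** Fix a vocabulary $\mathcal S$: a nonempty set of module names, each module name $M$ having an arity $ar(M)$ and an input arity $iar(M)\le ar(M)$ (natural numbers). Fix a countably infinite set $\mathbf{dom}$. An interpretation $D$ of $\mathcal S$ assigns to each module name $M$ an $ar(M)$-ary relation $D(M)$ over $\mathbf{dom}$. Fix a set $\mathbb V$ of variables (finite or infinite). A valuation is a function $\mathbb V\to\mathbf{dom}$; $\mathcal V$ is the set of all valuations. Valuations agree on $Y\subseteq\mathbb V$ if they have equal values on every $y\in Y$; they agree outside $Y$ if they agree on $\mathbb V- Y$. A BRV is a subset of $\mathcal V\times\mathcal V$; a global BRV is a function $Q$ mapping each interpretation $D$ to a BRV $Q(D)$. **Operations on BRVs** $A,B$ ($Z$ a finite set of variables; $x,y$ variables): union, intersection, set difference $A-B$; composition $A;B=\{(\nu_1,\nu_2)\mid\exists\nu_3:(\nu_1,\nu_3)\in A,(\nu_3,\nu_2)\in B\}$; converse $A^{-1}=\{(\nu_1,\nu_2)\mid(\nu_2,\nu_1)\in A\}$; left cylindrification $\mathrm{cyl}^l_Z(A)=\{(\nu_1,\nu_2)\mid\exists\nu_1':(\nu_1',\nu_2)\in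 A,\ \nu_1'\text{ and }\nu_1\text{ agree outside }Z\}$; right cylindrification $\mathrm{cyl}^r_Z(A)=\{(\nu_1,\nu_2)\mid\exists\nu_2':(\nu_1,\nu_2')\in A,\ \nu_2'\text{ and }\nu_2\text{ agree outside }Z\}$; selections $\sigma^l_{x=y}(A)=\{(\nu_1,\nu_2)\in A\mid\nu_1(x)=\nu_1(y)\}$, $\sigma^r_{x=y}(A)=\{(\nu_1,\nu_2)\in A\mid\nu_2(x)=\nu_2(y)\}$, $\sigma^{lr}_{x=y}(A)=\{(\nu_1,\nu_2)\in A\mid\nu_1(x)=\nu_2(y)\}$. **LIF expressions** over $\mathcal S$ are generated by $\alpha::=\mathit{id}\mid M(\bar x;\bar y)\mid\alpha\cup\alpha\mid\alpha\cap\alpha\mid\alpha-\alpha\mid\alpha;\alpha\mid\alpha^{-1}\mid\mathrm{cyl}^l_Z(\alpha)\mid\mathrm{cyl}^r_Z(\alpha)\mid\sigma^{lr}_{x=y}(\alpha)\mid\sigma^l_{x=y}(\alpha)\mid\sigma^r_{x=y}(\alpha)$, where in an atomic module expression $M(\bar x;\bar y)$ the tuples of variables $\bar x,\bar y$ have lengths $iar(M)$ and $ar(M)-iar(M)$. Semantics: $[\![\mathit{id}]\!]_D=\{(\nu,\nu)\mid\nu\in\mathcal V\}$; $[\![M(\bar x;\bar y)]\!]_D=\{(\nu_1,\nu_2)\mid\nu_1(\bar x)\cdot\nu_2(\bar y)\in D(M)\text{ and }\nu_1,\nu_2\text{ agree outside }\bar y\}$ ($\cdot$ is concatenation of tuples);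 the other operators are interpreted by the corresponding BRV operations. $[\![\alpha]\!]$ denotes the global BRV $D\mapsto[\![\alpha]\!]_D$. Two LIF expressions are equivalent if $[\![\cdot]\!]_D$ gives the same BRV for every interpretation $D$. **Semantic outputs and inputs.** $O^{\mathrm{sem}}(\alpha)$ is the set of variables $x$ for which there are an interpretation $D$ and $(\nu_1,\nu_2)\in[\![\alpha]\!]_D$ with $\nu_1(x)\ne\nu_2(x)$ (for a LIF expression this set is finite, so it may be used as the index of a cylindrification). For a global BRV $Q$ and $X,Y\subseteq\mathbb V$, $X$ determines $Q$ on $Y$ if for every interpretation $D$, every $(\nu_1,\nu_2)\in Q(D)$ and every valuation $\nu_1'$ agreeing with $\nu_1$ on $X$, there is $\nu_2'$ agreeing with $\nu_2$ on $Y$ such that $(\nu_1',\nu_2')\in Q(D)$. $I^{\mathrm{sem}}(\alpha)$ is the set of variables $x$ such that $\mathbb V-\{x\}$ does not determine $[\![\alpha]\!]$ on $O^{\mathrm{sem}}(\alpha)$. *)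

(* Defs.v *)
From mathcomp Require Import all_boot.
From mathcomp Require Import boolp classical_sets functions cardinality.

Set Implicit Arguments.
Unset Strict Implicit.
Unset Printing Implicit Defensive.

Local Open Scope classical_set_scope.

Record vocabulary := Vocabulary {
  module_name : Type;
  module_name_inhabited : inhabited module_name;
  ar : module_name -> nat;
  iar : module_name -> nat;
  iar_le_ar : forall M : module_name, iar M <= ar M
}.

Definition interpretation (S : vocabulary) (dom : Type) : Type :=
  forall M : module_name S, set ((ar M).-tuple dom).

Definition valuation (V dom : Type) : Type := V -> dom.

Definition BRV (V dom : Type) : Type :=
  set (valuation V dom * valuation V dom).

Definition global_BRV (S : vocabulary) (V dom : Type) : Type :=
  interpretation S dom -> BRV V dom.

Definition agree_on (V dom : Type) (Y : set V) (nu1 nu2 : valuation V dom) :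
  Prop := forall y, Y y -> nu1 y = nu2 y.

Definition agree_outside (V dom : Type) (Y : set V)
  (nu1 nu2 : valuation V dom) : Prop := agree_on (~` Y) nu1 nu2.

Section operations.
Variables V dom : Type.
Implicit Types (A B : BRV V dom) (Z : set V) (x y : V).

(* A first, then B; the library notation A \; B applies B first. *)
Definition comp A B : BRV V dom :=
  [set p | exists nu3, A (p.1, nu3) /\ B (nu3, p.2)].

Definition conv A : BRV V dom := [set p | A (p.2, p.1)].

Definition cyl_l Z A : BRV V dom :=
  [set p | exists nu1', A (nu1', p.2) /\ agree_outside Z nu1' p.1].

Definition cyl_r Z A : BRV V dom :=
  [set p | exists nu2', A (p.1, nu2') /\ agree_outside Z nu2' p.2].

Definition sel_l x y A : BRV V dom := [set p | A p /\ p.1 x = p.1 y].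

Definition sel_r x y A : BRV V dom := [set p | A p /\ p.2 x = p.2 y].

Definition sel_lr x y A : BRV V dom := [set p | A p /\ p.1 x = p.2 y].

End operations.

Inductive LIF (S : vocabulary) (V : Type) : Type :=
| Id
| Module (M : module_name S) (xs : (iar M).-tuple V)
    (ys : (ar M - iar M).-tuple V)
| Union of LIF S V & LIF S V
| Inter of LIF S V & LIF S V
| Diff of LIF S V & LIF S V
| Comp of LIF S V & LIF S V
| Conv of LIF S V
| CylL (Z : set V) of finite_set Z & LIF S V
| CylR (Z : set V) of finite_set Z & LIF S V
| SelLR of V & V & LIF S V
| SelL of V & V & LIF S V
| SelR of V & V & LIF S V.

Arguments Id {S V}.
Arguments CylL {S V} Z _ _.
Arguments CylR {S V} Z _ _.

(* The cast identifies tuples of length iar M + (ar M - iar M) with tuples of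
   length ar M; the underlying sequence is unchanged. *)
Definition module_tuple (S : vocabulary) (V dom : Type) (M : module_name S)
    (xs : (iar M).-tuple V) (ys : (ar M - iar M).-tuple V)
    (nu1 nu2 : valuation V dom) : (ar M).-tuple dom :=
  tcast (subnKC (iar_le_ar M)) [tuple of map nu1 xs ++ map nu2 ys].

Definition module_sem (S : vocabulary) (V dom : Type) (D : interpretation S dom)
    (M : module_name S) (xs : (iar M).-tuple V)
    (ys : (ar M - iar M).-tuple V) : BRV V dom :=
  [set p | D M (module_tuple xs ys p.1 p.2) /\
           agree_outside (range (tnth ys)) p.1 p.2].

Fixpoint sem (S : vocabulary) (V dom : Type) (a : LIF S V)
    (D : interpretation S dom) {struct a} : BRV V dom :=
  match a with
  | Id => [set p | p.1 = p.2]
  | Module M xs ys => module_sem D xs ys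
  | Union a b => sem a D `|` sem b D
  | Inter a b => sem a D `&` sem b D
  | Diff a b => sem a D `\` sem b D
  | Comp a b => comp (sem a D) (sem b D)
  | Conv a => conv (sem a D)
  | CylL Z _ a => cyl_l Z (sem a D)
  | CylR Z _ a => cyl_r Z (sem a D)
  | SelLR x y a => sel_lr x y (sem a D)
  | SelL x y a => sel_l x y (sem a D)
  | SelR x y a => sel_r x y (sem a D)
  end.

Definition lif_equiv (S : vocabulary) (V dom : Type) (a b : LIF S V) : Prop :=
  forall D : interpretation S dom, sem a D = sem b D.

Definition Osem (S : vocabulary) (V dom : Type) (a : LIF S V) : set V :=
  [set x | exists (D : interpretation S dom) (nu1 nu2 : valuation V dom),
             sem a D (nu1, nu2) /\ nu1 x <> nu2 x].

Definition determines (S : vocabulary) (V dom : Type) (X : set V)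
    (Q : global_BRV S V dom) (Y : set V) : Prop :=
  forall (D : interpretation S dom) (nu1 nu2 nu1' : valuation V dom),
    Q D (nu1, nu2) -> agree_on X nu1' nu1 ->
    exists nu2', agree_on Y nu2' nu2 /\ Q D (nu1', nu2').

Definition Isem (S : vocabulary) (V dom : Type) (a : LIF S V) : set V :=
  [set x | ~ determines (~` [set x])
               (sem a : global_BRV S V dom) (Osem dom a)].

Definition io_disjoint (S : vocabulary) (V dom : Type) (a : LIF S V) : Prop :=
  Osem dom a `&` Isem dom a = set0.

(* Needed to use Osem as the index of a cylindrification. *)
Lemma finite_Osem (S : vocabulary) (V dom : Type) (a : LIF S V) :
  finite_set (Osem dom a).
Proof.
have FU (A B C : set V) :
    finite_set A -> finite_set B -> C `<=` A `|` B -> finite_set C.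
  by move=> fA fB sC; apply: sub_finite_set sC _; rewrite finite_setU.
have neq_cyl (Z : set V) (u v w : valuation V dom) x :
    agree_outside Z v w -> u x <> w x -> Z x \/ u x <> v x.
  move=> vw uw; have [Zx|nZx] := pselect (Z x); [by left|right].
  by rewrite (vw x nZx).
elim: a => /=.
- apply: sub_finite_set (finite_set0 V) => x [D [u [v /= [uv]]]].
  by rewrite uv.
- move=> M xs ys; have fys : finite_set (range (tnth ys)).
    by apply: finite_image; exact: finite_finset.
  apply: sub_finite_set fys.
  move=> x [D [u [v /= [[_ uv] ux]]]].
  by apply: contrapT => nx; apply: ux; exact: uv.
- move=> a fa b fb; apply: FU fa fb _ => x [D [u [v /= [[ab|ab] ux]]]];
    by [left; exists D, u, v|right; exists D, u, v].
- move=> a fa b fb; apply: sub_finite_set fa => x [D [u [v /= [[ab _] ux]]]].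
  by exists D, u, v.
- move=> a fa b fb; apply: sub_finite_set fa => x [D [u [v /= [[ab _] ux]]]].
  by exists D, u, v.
- move=> a fa b fb; apply: FU fa fb _ => x [D [u [v /= [[w /= [uw wv]] ux]]]].
  have [uwx|uwx] := pselect (u x = w x).
    by right; exists D, w, v; split => //; rewrite -uwx.
  by left; exists D, u, w.
- move=> a fa; apply: sub_finite_set fa => x [D [u [v /= [ab ux]]]].
  by exists D, v, u; split=> //; exact/nesym.
- move=> Z fZ a fa; apply: (FU _ _ _ fZ fa) => x [D [u [v /= [[w /= [aw wu] ux]]]]].
  have [|vw] := neq_cyl _ _ _ _ _ wu (nesym ux); first by left.
  by right; exists D, w, v; split=> //; exact/nesym.
- move=> Z fZ a fa; apply: (FU _ _ _ fZ fa) => x [D [u [v /= [[w /= [aw wv] ux]]]]].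
  have [|uw] := neq_cyl _ _ _ _ _ wv ux; first by left.
  by right; exists D, u, w.
- move=> x y a fa; apply: sub_finite_set fa => z [D [u [v /= [[ab _] ux]]]].
  by exists D, u, v.
- move=> x y a fa; apply: sub_finite_set fa => z [D [u [v /= [[ab _] ux]]]].
  by exists D, u, v.
- move=> x y a fa; apply: sub_finite_set fa => z [D [u [v /= [[ab _] ux]]]].
  by exists D, u, v.
Qed.

(* Main.v *)
(** Let [(nu1, nu)] be in [alpha] and [(mu, nu2)] in [beta], where [nu] and
    [nu2] agree outside O(beta) and [mu] and [nu1] agree outside O(alpha).
    Pairs in [beta] agree outside O(beta), so [mu] and [nu] differ only on the
    finite set O(beta), which by io-disjointness contains no input of [beta].
    Changing the source of a pair of [beta] at a single variable of
    O(beta) - I(beta) leaves the target intact: on O(beta) by the definition of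
    inputs, and outside O(beta) because source and target agree there.
    Finitely many such changes turn [(mu, nu2)] into [(nu, nu2)]. *)
Require Import Defs.
From mathcomp Require Import all_boot.
From mathcomp Require Import boolp classical_sets functions cardinality.

Local Open Scope classical_set_scope.

Section semantic_inputs_outputs.
Context {S : vocabulary} {V dom : Type}.
Implicit Types (a : LIF S V) (D : interpretation S dom).
Implicit Types mu nu : valuation V dom.

Lemma sem_agree_outside a D mu nu :
  sem a D (mu, nu) -> agree_outside (Osem dom a) mu nu.
Proof.
move=> aD x nOx; apply: contrapT => neq; apply: nOx.
by exists D, mu, nu.
Qed.

Lemma sem_change1 a D mu mu' nu x :
  Osem dom a x -> ~ Isem dom a x -> agree_outside [set x] mu' mu ->
  sem a D (mu, nu) -> sem a D (mu', nu).
Proof.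
move=> Ox nIx mu'mu aD.
have [nu' [nu'nu aD']] := contrapT nIx D mu nu mu' aD mu'mu.
suff <- : nu' = nu by [].
apply/funext => y; have [Oy|nOy] := pselect (Osem dom a y); first exact: nu'nu.
(* Off O(a) targets copy their sources, and [y] differs from [x] because [x] lies in O(a). *)
rewrite -(sem_agree_outside _ _ _ _ aD' y nOy) mu'mu; last by move=> yx; rewrite yx in nOy.
exact: (sem_agree_outside _ _ _ _ aD).
Qed.

Lemma sem_change_outputs a D mu mu' nu :
  io_disjoint dom a -> agree_outside (Osem dom a) mu' mu ->
  sem a D (mu, nu) -> sem a D (mu', nu).
Proof.
move=> ioa.
have /(@finite_seqP {classic V})[s Os] := finite_Osem dom a.
have nI x : Osem dom a x -> ~ Isem dom a x.
  by move=> Ox Ix; have : set0 x by rewrite -ioa; split.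
(* The induction keeps only that [s] lies inside O(a), since a tail of the list need not enumerate
   O(a). *)
rewrite {1}Os; have : [set` s] `<=` Osem dom a by rewrite Os.
elim: s {Os} mu => [|x s IHs] mu sO mu'mu aD.
  by have -> : mu' = mu by apply/funext => y; apply: mu'mu.
have Ox : Osem dom a x by apply: sO; rewrite /= mem_head.
(* [mu1] differs from [mu] at most at [x], and from [mu'] only on the tail [s]. *)
pose mu1 y := if (y : {classic V}) == x then mu' y else mu y.
apply: (IHs mu1).
- by move=> y /= ys; apply: sO; rewrite /= in_cons ys orbT.
- move=> y nsy; rewrite /mu1; case: ifPn => // yx; apply: mu'mu.
  by rewrite /= in_cons (negPf yx).
- apply: (sem_change1 _ _ _ _ _ x Ox (nI x Ox) _ aD) => y yx.
  by rewrite /mu1; case: eqP.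
Qed.

End semantic_inputs_outputs.

Theorem theorem7p1 (S : vocabulary) (V dom : Type)
    (hdom : ([set: dom] #= [set: nat])%card)
    (alpha beta : LIF S V) (hbeta : io_disjoint dom beta) :
  lif_equiv dom
    (Comp alpha beta)
    (Inter (CylR (Osem dom beta) (finite_Osem dom beta) alpha)
           (CylL (Osem dom alpha) (finite_Osem dom alpha) beta)).
Proof.
move=> D; apply/seteqP; split=> -[nu1 nu2] /=.
  move=> [nu3 /= [aD bD]]; split; exists nu3; split=> //=.
    exact: sem_agree_outside bD.
  by move=> x nOx; rewrite (sem_agree_outside _ _ _ _ aD x nOx).
move=> [[nu /= [aD nu_nu2]] [mu /= [bD mu_nu1]]].
(* Outside O(beta), [nu] equals [nu2], which equals [mu]. *)
exists nu; split=> //=; apply: (sem_change_outputs _ _ _ _ _ hbeta _ bD) => x nOx.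
by rewrite nu_nu2// (sem_agree_outside _ _ _ _ bD x nOx).
Qed.
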